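(* Let $q\geq 7$ be an odd prime power, $m\geq 2$ and $n=\frac{q^m-1}{2}$. Then the negacyclic BCH code $\mathcal{C}_{(q,n,3,0)}$, whose generator polynomial is $\mathbb{M}_{\beta}(x)\mathbb{M}_{\beta^3}(x)$, has parameters $[n,n-2m,3]$ and is almost distance-optimal with respect to the sphere-packing bound.
   Context: Let $\ell$ be the order of $q$ modulo $2n$, $\alpha$ a primitive element of $\mathrm{GF}(q^\ell)$, $\beta=\alpha^{(q^\ell-1)/(2n)}$ (a primitive $2n$-th root of unity), and $\mathbb{M}_{\beta^j}(x)$ the minimal polynomial of $\beta^j$ over $\mathrm{GF}(q)$. $\mathcal{C}_{(q,n,3,0)}$ is the negacyclic code of length $n$ over $\mathrm{GF}(q)$, i.e. the ideal of $\mathrm{GF}(q)[x]/(x^n+1)$ generated by $\mathrm{lcm}(\mathbb{M}_{\beta}(x),\mathbb{M}_{\beta^3}(x))$. An $[n,k,d]$ code over $\mathrm{GF}(q)$ is almost distance-optimal with respect to the sphere-packing bound if the sphere-packing bound shows that every $[n,k]$ linear code over $\mathrm{GF}(q)$ has minimum distance at most $d+1$. *)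

(* Defs.v *)
From HB Require Import structures.
From mathcomp Require Import all_boot all_order all_algebra all_field.
Set Implicit Arguments. Unset Strict Implicit. Unset Printing Implicit Defensive.
Import GRing.Theory.
Local Open Scope ring_scope.

Definition lcm_poly (F : fieldType) (p q : {poly F}) : {poly F} :=
  (p * q) %/ gcdp p q.

Definition is_minpoly (F : fieldType) (L : fieldExtType F) (x : L)
    (M : {poly F}) : Prop :=
  [/\ M \is monic, root (map_poly (in_alg L) M) x &
      forall p : {poly F}, p != 0 -> root (map_poly (in_alg L) p) x ->
        (size M <= size p)%N].

(* The negacyclic code of length n over F generated by g: the ideal of
   F[x]/(x^n+1) generated by g, i.e. the residues (p * g) mod (x^n + 1),
   each identified with its coefficient vector in F^n. *)
Definition negacyclic_code (F : fieldType) (n : nat) (g : {poly F})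
    (c : 'rV[F]_n) : Prop :=
  exists p : {poly F}, c = poly_rV ((p * g) %% ('X^n + 1)).

Definition code_dim (F : fieldType) (n : nat) (C : 'rV[F]_n -> Prop) (k : nat)
  : Prop :=
  exists B : 'M[F]_(k, n), row_free B /\ forall c, C c <-> (c <= B)%MS.

Definition wt (F : fieldType) (n : nat) (c : 'rV[F]_n) : nat :=
  #|[set i : 'I_n | c 0 i != 0]|.

Definition min_dist (F : fieldType) (n : nat) (C : 'rV[F]_n -> Prop) (d : nat)
  : Prop :=
  (exists2 c, C c & c != 0 /\ wt c = d) /\
  (forall c, C c -> c != 0 -> (d <= wt c)%N).

Definition sphere_packing_ok (q n k d' : nat) : bool :=
  (q ^ k * \sum_(i < ((d'.-1)./2).+1) 'C(n, i) * (q.-1) ^ i <= q ^ n)%N.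

(* An [n,k,d] code over GF(q) is almost distance-optimal w.r.t. the
   sphere-packing bound: the bound forces every [n,k] code to have
   minimum distance at most d+1. *)
Definition almost_opt_sphere_packing (q n k d : nat) : Prop :=
  forall d' : nat, sphere_packing_ok q n k d' -> (d' <= d.+1)%N.

Arguments negacyclic_code {F} n g c.

(* Main.v *)
Require Import Defs.
From HB Require Import structures.
From mathcomp Require Import all_boot all_order all_algebra all_field.
From mathcomp Require Import zify ring.
Set Implicit Arguments.
Unset Strict Implicit.
Unset Printing Implicit Defensive.
Import GRing.Theory.
Local Open Scope ring_scope.

(** Since #|F|^m - 1 = 2n, the q-cyclotomic cosets of 1 and 3 modulo 2n are
    disjoint and have m elements, whence the dimension n - 2m.  A nonzero word
    of weight at most 2 vanishing at beta and beta^3 would give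
    beta^(2i) = beta^(2j) for two distinct positions i, j < n, which is absurd.
    A word of weight 3 is (X^h - a)(X^h - a^3) with h = (q^m - 1)/(q - 1) and
    a = beta^h, an element of F of order q - 1.  Balls of radius 2 are too big
    for the redundancy 2m: their size exceeds (2n + 1)^2 = q^(2m). *)

(** * Frobenius and minimal polynomials over [F] *)

Lemma horner_map_in_alg_expf_card (F : finFieldType) (L : fieldExtType F)
    (p : {poly F}) (x : L) (j : nat) :
  (map_poly (in_alg L) p).[x ^+ (#|F| ^ j)] =
  (map_poly (in_alg L) p).[x] ^+ (#|F| ^ j).
Proof.
have [c c_pr charFc] := finPcharP F.
have charL_card : [pchar L].-nat #|F|.
  by rewrite (card_pprimeChar charFc) pnatX pnatE // pchar_lalg charFc.
elim: j => [|j IHj]; first by rewrite expn0 !expr1.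
rewrite expnSr !exprM -{}IHj; move: (x ^+ _) => y.
elim/poly_ind: p => [|p a IHp]; first by
  rewrite rmorph0 !horner0 expr0n eqn0Ngt (ltnW (finNzRing_gt1 F)).
rewrite rmorphD rmorphM /= map_polyX map_polyC !hornerE.
(* Raising to the power [#|F|] is additive in this characteristic and fixes the coefficients, which
   come from [F]. *)
rewrite exprDn_pchar // exprMn IHp; congr (_ + _).
by rewrite -rmorphXn expf_card.
Qed.

Lemma root_map_in_alg_expf_card (F : finFieldType) (L : fieldExtType F)
    (p : {poly F}) (x : L) (j : nat) :
  root (map_poly (in_alg L) p) x ->
  root (map_poly (in_alg L) p) (x ^+ (#|F| ^ j)).
Proof.
rewrite !rootE horner_map_in_alg_expf_card => /eqP->.
by rewrite expr0n eqn0Ngt expn_gt0 (ltnW (finNzRing_gt1 F)).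
Qed.

Lemma minpoly_neq0 (F : fieldType) (L : fieldExtType F) (x : L)
    (M : {poly F}) :
  is_minpoly x M -> M != 0.
Proof. by case=> /monic_neq0. Qed.

Lemma minpoly_dvdp (F : fieldType) (L : fieldExtType F) (x : L)
    (M p : {poly F}) :
  is_minpoly x M -> M %| p = root (map_poly (in_alg L) p) x.
Proof.
move=> minM; have Mneq0 := minpoly_neq0 minM.
case: minM => _ Mx minM; apply/idP/idP => [/dvdpP[u ->]|px].
  by rewrite rmorphM rootM Mx orbT.
apply/modp_eq0P; apply/eqP.
apply: contraTT (ltn_modpN0 p Mneq0) => /minM rM.
rewrite -leqNgt rM //; move: px.
rewrite {1}(divp_eq p M) rmorphD rmorphM /= !rootE hornerD hornerM.
by rewrite (rootP Mx) mulr0 add0r.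
Qed.

(** Minimality is applied to the cofactor [e] of the gcd in [M]: [x] is not a root of the gcd, hence
    it is one of [e], so [e] is as large as [M] and the gcd is constant. *)
Lemma minpoly_coprimep (F : fieldType) (L : fieldExtType F) (x : L)
    (M p : {poly F}) :
  is_minpoly x M -> ~~ root (map_poly (in_alg L) p) x -> coprimep M p.
Proof.
move=> minM; have Mneq0 := minpoly_neq0 minM.
case: minM => _ Mx minM px; have /dvdpP[e eM] := dvdp_gcdl M p.
have /dvdpP[f ef] := dvdp_gcdr M p.
have : e * gcdp M p != 0 by rewrite -eM.
rewrite mulf_eq0 negb_or => /andP[e0 d0].
move: Mx; rewrite {1}eM rmorphM rootM => /orP[ex|dx]; last first.
  by case/negP: px; rewrite ef rmorphM rootM dx orbT.
have := minM _ e0 ex; rewrite {1}eM size_mul // /coprimep.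
move: d0 e0; rewrite -2!size_poly_gt0.
by move: (size e) (size (gcdp M p)) => a b; lia.
Qed.

Lemma size_minpoly_le (F : finFieldType) (m : nat) (L : fieldExtType F)
    (x : L) (M : {poly F}) :
  (0 < m)%N -> is_minpoly x M -> x ^+ (#|F| ^ m) = x -> (size M <= m.+1)%N.
Proof.
move=> m_gt0 [_ _ minM] xq; rewrite leqNgt; apply/negP => ltM.
(* The [#|F| ^ m.+1] values at [x] of the polynomials of size at most [m.+1]
   would be distinct roots of ['X^(#|F| ^ m) - 'X]. *)
pose ev (u : 'rV[F]_m.+1) := (map_poly (in_alg L) (rVpoly u)).[x].
have ev_inj : injective ev.
  move=> u v /eqP; rewrite -subr_eq0 /ev -hornerN -hornerD -rmorphB -linearB /=.
  case: (eqVneq (rVpoly (u - v)) 0) => [|/minM uv_neq0 /uv_neq0].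
    move=> /(congr1 (@poly_rV F m.+1)); rewrite rVpolyK linear0 => /eqP.
    by rewrite subr_eq0 => /eqP.
  by move/leq_trans/(_ (size_poly _ _)); rewrite leqNgt ltM.
have qm_gt1 : (1 < #|F| ^ m)%N by rewrite -(exp1n m) ltn_exp2r // finNzRing_gt1.
have szX : size ('X^(#|F| ^ m) - 'X : {poly L}) = (#|F| ^ m).+1.
  by rewrite size_polyDl ?size_polyXn // size_polyN size_polyX.
have szE : size [seq ev u | u : 'rV[F]_m.+1] = (#|F| ^ m.+1)%N.
  by rewrite size_map -cardE card_mx mul1n.
suff: (#|F| ^ m.+1 < (#|F| ^ m).+1)%N.
  by rewrite ltnS leq_exp2l ?finNzRing_gt1 // ltnn.
rewrite -szE -szX; apply: max_poly_roots.
- by rewrite -size_poly_gt0 szX.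
- apply/allP => _ /mapP[u _ ->]; rewrite rootE !hornerE subr_eq0.
  by rewrite -horner_map_in_alg_expf_card xq.
- by rewrite map_inj_uniq // enum_uniq.
Qed.

(** The listed conjugates of [x] are [m] distinct roots of [M], which gives the lower bound matching
    [size_minpoly_le]. *)
Lemma size_minpoly (F : finFieldType) (m : nat) (L : fieldExtType F)
    (x : L) (M : {poly F}) :
  (0 < m)%N -> is_minpoly x M -> x ^+ (#|F| ^ m) = x ->
  uniq [seq x ^+ (#|F| ^ j) | j <- iota 0 m] -> size M = m.+1.
Proof.
move=> m_gt0 minM xq uniq_x; apply/eqP.
rewrite eqn_leq (size_minpoly_le m_gt0 minM) //=.
have M0 := minpoly_neq0 minM; case: minM => _ Mx _.
have := max_poly_roots _ _ uniq_x; rewrite size_map size_iota.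
rewrite -(size_map_poly (in_alg L) M); apply; first by rewrite map_poly_eq0.
by apply/allP => _ /mapP[j _ ->]; apply: root_map_in_alg_expf_card.
Qed.

(** * Membership and dimension of negacyclic codes *)

Lemma negacyclic_codeP (F : fieldType) (n : nat) (g : {poly F}) (c : 'rV[F]_n) :
  (0 < n)%N -> g %| 'X^n + 1 -> negacyclic_code n g c <-> g %| rVpoly c.
Proof.
move=> n_gt0 g_dvd; have szN : size ('X^n + 1 : {poly F}) = n.+1.
  by rewrite size_XnaddC.
have N0 : 'X^n + 1 != 0 :> {poly F} by rewrite -size_poly_gt0 szN.
split=> [[p ->]|/dvdpP[u eu]].
  rewrite poly_rV_K; last by rewrite -ltnS -szN ltn_modp.
  by rewrite -(dvdp_mod _ g_dvd) dvdp_mulIr.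
by exists u; rewrite -eu modp_small ?rVpolyK // szN ltnS size_poly.
Qed.

Lemma negacyclic_code_dim (F : fieldType) (n r : nat) (g : {poly F}) :
  (0 < n)%N -> (r <= n)%N -> g %| 'X^n + 1 -> size g = r.+1 ->
  code_dim (negacyclic_code n g) (n - r)%N.
Proof.
move=> n_gt0 le_rn g_dvd szg; have g0 : g != 0 by rewrite -size_poly_gt0 szg.
have szM (u : 'rV[F]_(n - r)) : (size (rVpoly u * g)%R <= n)%N.
  have [->|u0] := eqVneq (rVpoly u) 0; first by rewrite mul0r size_poly0.
  have : (size (rVpoly u : {poly F}) <= n - r)%N by apply: size_poly.
  rewrite size_mul // szg addnS /=; move: (size _) => k; lia.
(* The encoder multiplies a message polynomial by [g]; by [szM] the product fits in [n]
   coefficients, so no reduction occurs. *)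
pose B : 'M[F]_(n - r, n) := lin1_mx (poly_rV \o (g \o* rVpoly)).
have BE u : rVpoly (u *m B) = rVpoly u * g by rewrite mul_rV_lin1 /= poly_rV_K.
exists B; split.
  apply: inj_row_free => u /(congr1 rVpoly); rewrite BE linear0 => /eqP.
  rewrite mulf_eq0 (negPf g0) orbF => /eqP/(congr1 (@poly_rV F (n - r))).
  by rewrite rVpolyK linear0.
move=> c; rewrite negacyclic_codeP //; split=> [/dvdpP[p cE]|/submxP[u ->]].
  have le_p : (size p <= n - r)%N.
    have [->|p0] := eqVneq p 0; first by rewrite size_poly0.
    have : (size (rVpoly c : {poly F}) <= n)%N by apply: size_poly.
    by rewrite cE size_mul // szg addnS /= leq_subRL // addnC.
  apply/submxP; exists (poly_rV p); apply: (can_inj rVpolyK).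
  by rewrite BE poly_rV_K.
by rewrite BE dvdp_mull.
Qed.

(** Summing over the support only turns a root of a word of weight 1 or 2 into an explicit relation
    with one or two terms. *)
Lemma horner_map_rVpoly (F : fieldType) (L : fieldExtType F) (n : nat)
    (c : 'rV[F]_n) (y : L) :
  (map_poly (in_alg L) (rVpoly c)).[y] =
  \sum_(i in [set i | c 0 i != 0]) (c 0 i)%:A * y ^+ i.
Proof.
rewrite (@horner_coef_wide _ n) ?size_map_poly ?size_poly //.
rewrite [RHS]big_mkcond; apply: eq_bigr => i _.
rewrite inE coef_map coef_rVpoly_ord /=; case: eqP => //= ->.
by rewrite scale0r mul0r.
Qed.

(** * Powers of a primitive root and cyclotomic cosets *)

Lemma prim_root_half_expr (R : idomainType) (n : nat) (z : R) :
  n.*2.-primitive_root z -> z ^+ n = -1.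
Proof.
move=> prim_z; have n_gt0 : (0 < n)%N by have := prim_order_gt0 prim_z; lia.
have := prim_expr_order prim_z; rewrite -muln2 exprM => /eqP.
rewrite sqrf_eq1 -(prim_order_dvd prim_z) => /orP[/dvdn_leq|/eqP//].
by move/(_ n_gt0); lia.
Qed.

(** The product is at most [3 * q ^ m.-1], and [q] is at least 7. Such exponents are their own
    residues modulo [q ^ m - 1], so equal powers of a primitive root mean equal exponents. *)
Lemma cyclotomic_coset_lt (q m i j : nat) :
  (7 <= q)%N -> (2 <= m)%N -> (i <= 3)%N -> (j < m)%N ->
  (i * q ^ j < (q ^ m).-1)%N.
Proof.
move=> q7 m2 i3 ltjm.
have le_j : (q ^ j <= q ^ m.-1)%N by rewrite leq_pexp2l //; lia.
have e : (q ^ m = q * q ^ m.-1)%N by rewrite -expnS prednK //; lia.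
have : (1 < q ^ m.-1)%N by rewrite -(exp1n m.-1) ltn_exp2r; lia.
rewrite e; nia.
Qed.

Lemma uniq_conjugates (R : idomainType) (q m N : nat) (z : R) (i : nat) :
  (7 <= q)%N -> (2 <= m)%N -> (0 < i <= 3)%N -> N = (q ^ m).-1 ->
  N.-primitive_root z -> uniq [seq (z ^+ i) ^+ (q ^ j) | j <- iota 0 m].
Proof.
move=> q7 m2 /andP[i0 i3] -> prim_z.
rewrite map_inj_in_uniq ?iota_uniq // => j k.
rewrite !mem_iota /= => jm km /eqP.
rewrite -!exprM (eq_prim_root_expr prim_z) !modn_small ?cyclotomic_coset_lt //.
rewrite eqn_pmul2l // eqn_exp2l; last lia.
by move/eqP.
Qed.

(** * The sphere-packing bound *)

Lemma sphere_packing_distance_le4 (q m n : nat) :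
  (7 <= q)%N -> (2 * m <= n)%N -> (q ^ m = n.*2.+1)%N -> (1 < n)%N ->
  almost_opt_sphere_packing q n (n - 2 * m) 3.
Proof.
move=> q7 le_mn qm n1 d; rewrite /sphere_packing_ok; apply: contraTT.
rewrite -!ltnNge => d_gt4.
have e : (q ^ n = q ^ (n - 2 * m) * (n.*2.+1 * n.*2.+1))%N.
  by rewrite -qm -!expnD; congr (_ ^ _)%N; lia.
rewrite e ltn_pmul2l ?expn_gt0 //; last lia.
(* As [d] is at least 5, the radius is at least 2, and the first three terms of the sum suffice. *)
have [k ->] : exists k, d.-1./2 = k.+2 by exists (d.-1./2).-2; lia.
rewrite !big_ord_recl /= /bump /= !add1n bin0 bin1 expn0 expn1.
have := bin_ffact n 2; rewrite !ffactnS ffactn0 muln1 /= (_ : 2`! = 2)%N //.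
have : (36 <= q.-1 ^ 2)%N by rewrite (leq_sqr 6); lia.
move: 'C(n, 2) (q.-1 ^ 2)%N (\sum_(i < k) _)%N => c s r s36 c2.
have : (c * 36 <= c * s)%N by rewrite leq_mul2l s36 orbT.
have : (n * 6 <= n * q.-1)%N by rewrite leq_mul2l; lia.
(* With [q.-1] at least 6 the ball has at least [1 + 6n + 18n(n - 1)] words, more than [(2n + 1)^2]
   once [n] is at least 2. *)
move: (n * q.-1)%N (c * s)%N => a b; nia.
Qed.

(** * Minimum distance: the lower bound and a word of weight 3 *)

Lemma wt_ge3_of_root (F : fieldType) (L : fieldExtType F) (n : nat) (z : L)
    (c : 'rV[F]_n) :
  n.*2.-primitive_root z -> c != 0 ->
  root (map_poly (in_alg L) (rVpoly c)) z ->
  root (map_poly (in_alg L) (rVpoly c)) (z ^+ 3) -> (3 <= wt c)%N.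
Proof.
move=> prim_z c_neq0; rewrite !rootE !horner_map_rVpoly /wt.
set S := [set i | _]; move=> c1 c3.
have z_neq0 : z != 0.
  by rewrite (prim_root_eq0 prim_z); have := prim_order_gt0 prim_z; lia.
have term_neq0 i k : i \in S -> (c 0 i)%:A * z ^+ k != 0.
  rewrite inE => ci; rewrite mulf_neq0 ?expf_neq0 //.
  by rewrite scaler_eq0 (negPf ci) oner_eq0.
have : (0 < #|S|)%N.
  rewrite card_gt0; apply: contraNneq c_neq0 => S0; apply/eqP/rowP => i.
  by rewrite mxE; apply/eqP; have := in_set0 i; rewrite -S0 inE => /negbFE.
case E: #|S| => [|[|[|k]]] //= _.
- move/eqP/cards1P: E => [i Si]; move: c1; rewrite Si big_set1.
  by rewrite (negPf (term_neq0 _ _ _)) // Si set11.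
- move/eqP/cards2P: E => [i [j [ij Sij]]].
  move: c1 c3; rewrite Sij !big_setU1 ?inE //= !big_set1 => /eqP c1 /eqP c3.
  (* Subtracting [z ^+ (2 * j)] times the relation at [z] from the one at [z ^+ 3] cancels the term
     of position [j]. *)
  have : (c 0 i)%:A * z ^+ i * ((z ^+ 2) ^+ i - (z ^+ 2) ^+ j) == 0.
    have cubeE (k : nat) : (z ^+ 3) ^+ k = z ^+ k * (z ^+ 2) ^+ k.
      by rewrite -exprMn -exprS.
    apply/eqP; transitivity (0 - 0 * (z ^+ 2) ^+ j); last by rewrite mul0r subrr.
    by rewrite -{1}c3 -c1 !cubeE; ring.
  rewrite mulf_eq0 (negPf (term_neq0 _ _ _)) ?Sij ?set21 //= subr_eq0 -!exprM.
  (* As [i] and [j] are below [n], their doubles are already reduced modulo [n.*2]. *)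
  rewrite (eq_prim_root_expr prim_z).
  rewrite !modn_small -?muln2 ?[(2 * _)%N]mulnC ?ltn_pmul2r //.
  by rewrite eqn_pmul2r // => /eqP/val_inj eij; rewrite eij eqxx in ij.
Qed.

Lemma exists_trinomial (F : finFieldType) (L : fieldExtType F) (m n : nat)
    (z : L) :
  (7 <= #|F|)%N -> (2 <= m)%N -> n.*2 = (#|F| ^ m).-1 ->
  n.*2.-primitive_root z ->
  exists p : {poly F}, [/\ (size p <= n)%N, wt (poly_rV p : 'rV_n) = 3,
    root (map_poly (in_alg L) p) z & root (map_poly (in_alg L) p) (z ^+ 3)].
Proof.
move=> q7 m2 n2E prim_z.
(* [z ^+ h] generates the multiplicative group of [F]. *)
pose h := (\sum_(i < m) #|F| ^ i)%N.
have hE : n.*2 = (#|F|.-1 * h)%N by rewrite n2E predn_exp.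
have h_gt0 : (0 < h)%N by have := prim_order_gt0 prim_z; rewrite hE; lia.
have [a za] : exists a : F, z ^+ h = a%:A.
  (* Since [(q - 1) * h = 2n], the element [z ^+ h] is fixed by Frobenius; the roots of this
     polynomial are exactly the elements of [F]. *)
  have : root (map_poly (in_alg L) ('X^#|F| - 'X)) (z ^+ h).
    rewrite rmorphB /= map_polyXn map_polyX rootE !hornerE subr_eq0.
    rewrite -exprM -(prednK (ltnW (finNzRing_gt1 F))) mulnS exprD.
    by rewrite mulnC -hE (prim_expr_order prim_z) mulr1.
  rewrite finField_genPoly rmorph_prod /= => /rootP.
  rewrite horner_prod => /eqP/prodf_eq0[a _].
  by rewrite rmorphB /= map_polyX map_polyC !hornerE subr_eq0 => /eqP; exists a.
have aX k : (0 < k < #|F|.-1)%N -> a ^+ k != 1.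
  move=> /andP[k0 kq]; rewrite -(fmorph_eq1 (in_alg L)) rmorphXn /= -za -exprM.
  rewrite -(prim_order_dvd prim_z) hE (mulnC h) dvdn_pmul2r //.
  by apply/negP => /dvdn_leq; lia.
have a_neq0 : a != 0.
  rewrite -(fmorph_eq0 (in_alg L)) /= -za expf_neq0 //.
  by rewrite (prim_root_eq0 prim_z); have := prim_order_gt0 prim_z; lia.
(* This keeps the middle coefficient [a + a ^+ 3 = a * (1 + a ^+ 2)] nonzero; [aX] applies to 4
   because [q - 1] is at least 6. *)
have a2 : a ^+ 2 != -1.
  apply: contra_neq (aX 4 _) => [a2|]; last lia.
  by rewrite (exprM a 2 2) a2 expr2 mulrNN mulr1.
(* From [2n = (q - 1) * h] and [q - 1] at least 6, [n] is at least [3 * h]. *)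
have lt2hn : (2 * h < n)%N by nia.
(* The first factor vanishes at [z], the second at [z ^+ 3]. *)
exists (('X^h - a%:P) * ('X^h - (a ^+ 3)%:P)).
set p := _ * _.
have pE : p = 'X^(2 * h) - (a + a ^+ 3) *: 'X^h + (a ^+ 4)%:P.
  rewrite /p mulnC exprM -!mul_polyC !(polyCD, polyC_exp); ring.
have coefp (k : nat) : p`_k = (k == 2 * h)%N%:R - (a + a ^+ 3) * (k == h)%:R
                              + (if k == 0%N then a ^+ 4 else 0).
  by rewrite pE !coefE.
have h_neq2h : (h == 2 * h)%N = false by lia.
have [zero_neq2h zero_neqh] : (0 == 2 * h)%N = false /\ (0 == h)%N = false.
  by split; lia.
have n_gt0 : (0 < n)%N by lia.
have lthn : (h < n)%N by lia.
have szp : (size p <= n)%N.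
  apply/leq_sizeP => k le_nk; rewrite coefp.
  have -> : (k == 2 * h)%N = false by lia.
  have -> : (k == h)%N = false by lia.
  have -> : (k == 0)%N = false by lia.
  by rewrite mulr0 subr0 addr0.
split=> //.
- rewrite /wt (_ : [set i | _] =
    [set Ordinal n_gt0; Ordinal lthn; Ordinal lt2hn]); last first.
    apply/setP => i; rewrite !inE mxE coefp -!val_eqE /=.
    have [->|i0] := eqVneq (i : nat) 0%N.
      by rewrite zero_neq2h zero_neqh mulr0 subr0 add0r expf_neq0.
    have [->|ih] := eqVneq (i : nat) h.
      rewrite h_neq2h mulr1 addr0 sub0r oppr_eq0 /=.
      rewrite -[X in X + _]mulr1 exprS -mulrDr mulf_neq0 //.
      by rewrite addrC addr_eq0.
    by rewrite mulr0 subr0 addr0; case: (i == _ :> nat);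
      rewrite ?oner_eq0 ?eqxx.
  rewrite -setUA !cardsU1 cards1 !inE -!val_eqE /=.
  by rewrite h_neq2h zero_neq2h zero_neqh.
- rewrite rmorphM rootM rmorphB /= map_polyXn map_polyC rootE !hornerE /=.
  by rewrite za subrr eqxx.
- rewrite rmorphM rootM !rmorphB /=.
  rewrite !map_polyXn !map_polyC /= !rootE !hornerE /=.
  by rewrite -exprM mulnC exprM za -in_algE -rmorphXn subrr eqxx orbT.
Qed.

(** * Parameters and near-optimality of the code *)

Unset Implicit Arguments.

Theorem theorem39 (F : finFieldType) (m : nat)
  (L : fieldExtType F) (beta : L) (M1 M3 : {poly F}) :
  odd #|F| -> (7 <= #|F|)%N -> (2 <= m)%N ->
  let n := ((#|F| ^ m).-1)./2 in
  (n.*2).-primitive_root beta ->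
  is_minpoly beta M1 -> is_minpoly (beta ^+ 3) M3 ->
  let g := lcm_poly M1 M3 in
  [/\ g %= M1 * M3,
      code_dim (negacyclic_code n g) (n - 2 * m)%N,
      min_dist (negacyclic_code n g) 3
    & almost_opt_sphere_packing #|F| n (n - 2 * m)%N 3].
Proof.
move=> odd_q q7 m2 n prim minM1 minM3 g.
have n2E : n.*2 = (#|F| ^ m).-1.
  rewrite /n; have := oddX #|F| m; rewrite odd_q orbT.
  by move: (#|F| ^ m)%N => N; lia.
have qmE : (#|F| ^ m)%N = n.*2.+1.
  by rewrite n2E prednK // expn_gt0; lia.
have le_2mn : (7 * m <= #|F| ^ m)%N.
  rewrite -{2}(prednK (ltnW m2)) expnS.
  have : (m.-1 < #|F| ^ m.-1)%N by apply: ltn_expl; lia.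
  nia.
have betaq (x : L) : x ^+ n.*2 = 1 -> x ^+ (#|F| ^ m) = x.
  by move=> x2n; rewrite qmE exprS x2n mulr1.
have beta2n := prim_expr_order prim.
have beta3_2n : (beta ^+ 3) ^+ n.*2 = 1.
  by rewrite -exprM mulnC exprM beta2n expr1n.
have uniq1 : uniq [seq beta ^+ (#|F| ^ j) | j <- iota 0 m].
  by have := uniq_conjugates (i := 1) q7 m2 isT n2E prim; rewrite expr1.
have uniq3 := uniq_conjugates (i := 3) q7 m2 isT n2E prim.
have m_gt0 : (0 < m)%N by lia.
have szM1 := size_minpoly m_gt0 minM1 (betaq _ beta2n) uniq1.
have szM3 := size_minpoly m_gt0 minM3 (betaq _ beta3_2n) uniq3.
have M1_neq0 := minpoly_neq0 minM1.
have M3_neq0 := minpoly_neq0 minM3.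
have M1_beta : root (map_poly (in_alg L) M1) beta by case: minM1.
have not_conj : ~~ root (map_poly (in_alg L) M1) (beta ^+ 3).
  apply/negP => M1_beta3.
  (* Together with the [m] conjugates of [beta], [beta ^+ 3] would give [M1] one root more than its
     degree. *)
  suff: (m.+1 < size M1)%N by rewrite szM1 ltnn.
  have := max_poly_roots (p := map_poly (in_alg L) M1)
    (rs := beta ^+ 3 :: [seq beta ^+ (#|F| ^ j) | j <- iota 0 m]).
  rewrite /= size_map size_iota size_map_poly map_poly_eq0 M1_beta3 uniq1 andbT.
  apply=> //=.
    by apply/allP => _ /mapP[j _ ->]; apply: root_map_in_alg_expf_card.
  apply/mapP => -[j]; rewrite mem_iota /= add0n => jm /eqP.
  rewrite (eq_prim_root_expr prim) n2E !modn_small; last 2 first.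
  - by have := cyclotomic_coset_lt (i := 1) q7 m2 isT jm; rewrite mul1n.
  - by have := cyclotomic_coset_lt (i := 3) q7 m2 isT m_gt0; rewrite expn0.
  (* The equation is now [3 = q ^ j]: [j = 0] gives 1, and any larger [j] at least 7. *)
  case: j {jm} => [|j]; first by rewrite expn0.
  have : (0 < #|F| ^ j)%N by rewrite expn_gt0; lia.
  rewrite expnS => qj_gt0; apply/negP.
  by rewrite ltn_eqF // (leq_trans _ (leq_mul q7 qj_gt0)).
have cop : coprimep M1 M3.
  by rewrite coprimep_sym; apply: minpoly_coprimep minM3 _.
have g_eqp : g %= M1 * M3.
  (* [gcdp] is determined only up to a unit, so coprimality yields association with [M1 * M3] rather
     than equality. *)
  rewrite -[X in _ %= X](divpK (dvdp_mulr M3 (dvdp_gcdl M1 M3))) -/g.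
  by rewrite eqp_sym -[X in _ %= X]mulr1 eqp_mull // gcdp_eqp1.
have g_dvdE p : (g %| p) =
    root (map_poly (in_alg L) p) beta &&
    root (map_poly (in_alg L) p) (beta ^+ 3).
  rewrite (eqp_dvdl p g_eqp) Gauss_dvdp //.
  by rewrite (minpoly_dvdp _ minM1) (minpoly_dvdp _ minM3).
have szg : size g = (2 * m).+1.
  by rewrite (eqp_size g_eqp) size_mul // szM1 szM3; lia.
have betan := prim_root_half_expr prim.
have g_dvd : g %| 'X^n + 1.
  (* Both [beta] and [beta ^+ 3] have [n]-th power -1, the latter because 3 is odd. *)
  rewrite g_dvdE !rootE rmorphD /= map_polyXn rmorph1 !hornerE.
  by rewrite -exprM mulnC exprM betan -signr_odd expr1 addNr eqxx.
have n_gt0 : (0 < n)%N by lia.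
split=> //.
- by apply: negacyclic_code_dim => //; lia.
- split=> [|c /(negacyclic_codeP _ n_gt0 g_dvd)]; last first.
    rewrite g_dvdE => /andP[c1 c3] c0.
    exact: wt_ge3_of_root prim c0 c1 c3.
  have [p [szp wt_p p1 p3]] := exists_trinomial q7 m2 n2E prim.
  exists (poly_rV p).
    by apply/(negacyclic_codeP _ n_gt0 g_dvd); rewrite poly_rV_K // g_dvdE p1.
  split=> //; apply: contra_eq_neq wt_p => ->.
  by rewrite /wt eq_card0 // => i; rewrite inE mxE eqxx.
- by apply: sphere_packing_distance_le4 => //; lia.
Qed.
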